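(* Consider the online maximum $k$-interval coverage problem in the FL-UN setting with quota $k\ge 2$, known maximum length $m>1$ and known total number $n\ge k+1$ of released sub-intervals. Then no online deterministic algorithm can achieve a competitive ratio better than $$\frac{2km}{2km+(1-m)\min\{k,n-k\}},$$ and this quantity is strictly smaller than $2$.
   Context: Online maximum $k$-interval coverage problem: there is a target interval $[0,a]$ (part of the instance). Sub-intervals $V_1,V_2,\dots$ with $V_i=[o_i,d_i]\subseteq[0,a]$ are released one at a time in an adversarial order. On the release of $V_i$ the algorithm must immediately and irrevocably accept or reject it, without knowledge of future sub-intervals. At most $k$ sub-intervals may be accepted. For a set $U$ of sub-intervals let $Len(U)=|\bigcup_{V\in U}V|$; the goal is to maximize $Len(U)$ for the accepted set $U$. $\mathrm{ALG}(\mathbb{V})$ is the value obtained by ALG on instance $\mathbb{V}$, $\mathrm{OPT}(\mathbb{V})$ the maximum of $Len(U)$ over $U\subseteq\mathbb{V}$, $|U|\le k$. ALG is $\rho$-competitive if $\mathrm{OPT}(\mathbb{V})\le\rho\,\mathrm{ALG}(\mathbb{V})$ for all instances. FL-UN setting: every released sub-interval has length $d_i-o_i\in[1,m]$ for a known constant $m>1$ (Flexible Length), and the total number $n$ of released sub-intervals is known in advance (Unique Number), with $n\ge k+1$. *)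

(* Defs.v *)
From mathcomp Require Import all_boot all_order all_algebra.
From mathcomp Require Import all_classical all_reals all_analysis.

Set Implicit Arguments.
Unset Strict Implicit.
Unset Printing Implicit Defensive.

Import Order.TTheory GRing.Theory Num.Theory.

Local Open Scope classical_set_scope.
Local Open Scope ring_scope.

(* The pair (o, d) stands for the sub-interval [o, d]. *)
Definition subinterval (R : realType) : Type := (R * R)%type.

(* The sub-intervals are listed in their order of release. They are referred to
   by their index, so that the same sub-interval may be released repeatedly. *)
Definition FL_UN_instance (R : realType) (m : R) (n : nat) (a : R)
    (V : n.-tuple (subinterval R)) : Prop :=
  forall i : 'I_n,
    let: (o, d) := tnth V i in
    [/\ 0 <= o, d <= a, 1 <= d - o & d - o <= m].

Definition Len (R : realType) (n : nat) (V : n.-tuple (subinterval R))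
    (U : {set 'I_n}) : \bar R :=
  lebesgue_measure
    (\bigcup_(i in [set` U]) [set` `[(tnth V i).1, (tnth V i).2]] : set R).

(* Len is nonnegative and set0 is one of the competing sets, so the default
   value 0 of the iterated maximum is harmless. *)
Definition OPT (R : realType) (k n : nat) (V : n.-tuple (subinterval R)) :
    \bar R :=
  \big[maxe/0%E]_(U : {set 'I_n} | (#|U| <= k)%N) Len V U.

(* [A a past v] tells whether v is accepted when the target interval is [0, a]
   and the sub-intervals in [past] were released, in this order, before v. The
   earlier decisions are not arguments, being themselves determined by A, a and
   [past]; k, m and n are known to the algorithm because A is chosen after
   them. *)
Definition decision_rule (R : realType) : Type :=
  R -> seq (subinterval R) -> subinterval R -> bool.

Definition accepted (R : realType) (n : nat) (A : decision_rule R) (a : R)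
    (V : n.-tuple (subinterval R)) : {set 'I_n} :=
  [set i : 'I_n | A a (take i V) (tnth V i)].

Definition online_algorithm (R : realType) (k : nat) (m : R) (n : nat)
    (A : decision_rule R) : Prop :=
  forall (a : R) (V : n.-tuple (subinterval R)),
    FL_UN_instance m a V -> (#|accepted A a V| <= k)%N.

Definition ALG (R : realType) (n : nat) (A : decision_rule R) (a : R)
    (V : n.-tuple (subinterval R)) : \bar R :=
  Len V (accepted A a V).

Definition competitive (R : realType) (k : nat) (m : R) (n : nat)
    (A : decision_rule R) (rho : R) : Prop :=
  forall (a : R) (V : n.-tuple (subinterval R)),
    FL_UN_instance m a V -> (OPT k V <= rho%:E * ALG A a V)%E.

(* Main.v *)
(* The adversary first releases k disjoint unit intervals, of which the algorithm
   accepts x. Let p = min(k, n-k). If x <= k - p/2, the remaining n-k releases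
   repeat an accepted interval (the first one if x = 0), so that OPT = k while
   ALG <= max(x, 1). Otherwise they are new disjoint intervals of length m: OPT reaches
   p m + k - p, but only k - x places are left to the algorithm, which gets at
   most m k - (m-1) x. This is at least (m-1) p / 2 less than OPT <= k m. *)
Require Import Defs.
From mathcomp Require Import all_boot all_order all_algebra.
From mathcomp Require Import all_classical all_reals all_analysis.
From mathcomp Require Import lra zify.
Import Order.TTheory GRing.Theory Num.Theory.

Local Open Scope ring_scope.

(** * Length of a union of intervals *)

Lemma LenE {R : realType} {n : nat} (V : n.-tuple (subinterval R))
    (U : {set 'I_n}) :
  Len V U = lebesgue_measure
    (\big[setU/set0]_(i in U) `[(tnth V i).1, (tnth V i).2]%classic).
Proof. by rewrite /Len -bigcup_pred. Qed.

Lemma subinterval_measure {R : realType} (v : subinterval R) : v.1 <= v.2 ->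
  lebesgue_measure `[v.1, v.2]%classic = (v.2 - v.1)%:E.
Proof.
rewrite lebesgue_measure_itv /= lte_fin le_eqVlt => /orP[/eqP->|->]//.
by rewrite ltxx subrr.
Qed.

Lemma Len_le_sum {R : realType} {n : nat} (V : n.-tuple (subinterval R))
    (U : {set 'I_n}) :
  (forall i, (tnth V i).1 <= (tnth V i).2) ->
  (Len V U <= (\sum_(i in U) ((tnth V i).2 - (tnth V i).1))%:E)%E.
Proof.
move=> V_le; rewrite LenE -sumEFin.
(* Measurability is carried along with the bound, since subadditivity for two sets requires it at
   each union. *)
pose mW (W : set R) (s : \bar R) :=
  measurable W /\ (lebesgue_measure W <= s)%E.
suff [] : mW (\big[setU/set0]_(i in U) `[(tnth V i).1, (tnth V i).2]%classic)
  (\sum_(i in U) ((tnth V i).2 - (tnth V i).1)%:E)%E by [].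
apply: (big_ind2 mW) => [|W s W' s' [mW1 W1s] [mW2 W2s]|i _].
- by split; rewrite ?measure0.
- split; first exact: measurableU.
  by apply: le_trans (leeD W1s W2s); apply: measureU2.
- by split; [exact: measurable_itv|rewrite subinterval_measure].
Qed.

Lemma Len_disjoint {R : realType} {n : nat} (V : n.-tuple (subinterval R))
    (U : {set 'I_n}) :
  (forall i, (tnth V i).1 <= (tnth V i).2) ->
  {in U &, forall i j : 'I_n, (i < j)%N -> (tnth V i).2 < (tnth V j).1} ->
  Len V U = (\sum_(i in U) ((tnth V i).2 - (tnth V i).1))%:E.
Proof.
move=> V_le V_lt; rewrite LenE measure_bigsetU_ord_cond.
- by rewrite -sumEFin; apply: eq_bigr => i _; apply: subinterval_measure.
- by move=> i _; apply: measurable_itv.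
- move=> i j Ui Uj [x [/=]]; rewrite !in_itv /= => /andP[ix xi] /andP[jx xj].
  apply/val_inj; case: (ltngtP i j) => // ij.
    by have := V_lt i j Ui Uj ij; rewrite ltNge (le_trans jx xi).
  by have := V_lt j i Uj Ui ij; rewrite ltNge (le_trans ix xj).
Qed.

(** Indices are compared through the intervals they carry, so accepting a repeated interval adds
    nothing to [Len]. *)
Lemma Len_subset {R : realType} {n : nat} (V : n.-tuple (subinterval R))
    (U U' : {set 'I_n}) :
  (forall i, i \in U -> exists2 j, j \in U' & tnth V j = tnth V i) ->
  (Len V U <= Len V U')%E.
Proof.
move=> UU'; apply: le_measure; rewrite ?inE.
- by apply: fin_bigcup_measurable => // i _; apply: measurable_itv.
- by apply: fin_bigcup_measurable => // i _; apply: measurable_itv.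
- by move=> x [i /UU'[j U'j Vij] Vx]; exists j => //; rewrite Vij.
Qed.

(** * From one instance to a bound on the ratio *)

Lemma le_OPT {R : realType} {k n : nat} (V : n.-tuple (subinterval R))
    (U : {set 'I_n}) : (#|U| <= k)%N -> (Len V U <= OPT k V)%E.
Proof. by move=> Uk; rewrite /OPT; apply: le_bigmax_cond. Qed.

(** Competitiveness gives [opt <= rho * alg]. The comparison of [N / D] with [opt / alg] is
    cross-multiplied, so that [alg] need not be shown positive. *)
Lemma competitive_lower_bound {R : realType} {k n : nat} {m : R}
    {A : decision_rule R} {rho : R} (a : R) (V : n.-tuple (subinterval R))
    (opt alg N D : R) :
  competitive k m n A rho -> FL_UN_instance m a V ->
  (opt%:E <= OPT k V)%E -> (ALG A a V <= alg%:E)%E ->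
  0 < opt -> 0 < D -> N * alg <= D * opt -> 0 <= N -> N / D <= rho.
Proof.
move=> comp inst le_opt le_alg opt_gt0 D_gt0 NalgD N_ge0.
have alg_ge0 : (0 <= ALG A a V)%E by apply: measure_ge0.
have := le_trans le_opt (comp a V inst).
case: (ALG A a V) le_alg alg_ge0 => [x| |] //=; rewrite !lee_fin => x_le x_ge0 le_x.
(* The sign of [rho] is needed to replace the true value [x] by its upper bound [alg]. *)
have rho_ge0 : 0 <= rho.
  rewrite leNgt; apply/negP => rho_lt0.
  have := lt_le_trans opt_gt0 le_x.
  by rewrite ltNge mulr_le0_ge0 // ltW.
rewrite ler_pdivrMr // -(ler_pM2r opt_gt0).
apply: le_trans (_ : N * (rho * alg) <= _).
  by rewrite ler_wpM2l // (le_trans le_x) // ler_wpM2l.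
by rewrite mulrCA -mulrA ler_wpM2l.
Qed.

(** * Counting indices, summing two kinds of lengths, prefixes *)

Lemma card_ord_range {n p q : nat} : (p <= q <= n)%N ->
  #|[set i : 'I_n | (p <= i < q)%N]| = (q - p)%N.
Proof.
move=> /andP[pq qn].
rewrite -[RHS]muln1 -sum_nat_const_nat (big_nat_widen _ _ n) //.
rewrite (big_nat_widenl p 0) // big_mkord -sum1dep_card.
by apply: eq_bigl => i; rewrite andbC.
Qed.

(** Reduces a total length to two cardinalities; it serves both to evaluate an offline choice and to
    bound the algorithm. *)
Lemma sum_short_long {R : realType} {n k : nat} (m : R) (U : {set 'I_n}) :
  \sum_(i in U) (if (i < k)%N then 1 else m) =
  m * #|U|%:R - (m - 1) * #|U :&: [set i : 'I_n | (i < k)%N]|%:R.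
Proof.
rewrite (eq_bigr (fun i : 'I_n => m - (if (i < k)%N then m - 1 else 0))); last first.
  by move=> i _; case: ifP => _; lra.
rewrite sumrB sumr_const mulr_natr -big_mkcondr /=; congr (_ - _).
by rewrite mulr_natr -sumr_const; apply: eq_bigl => i; rewrite !inE.
Qed.

Lemma take_mktuple {T : Type} {n : nat} (f : nat -> T) (i : nat) : (i <= n)%N ->
  take i [tuple f (j : 'I_n) | j < n] = [seq f j | j <- iota 0 i].
Proof.
move=> i_le; rewrite /= (map_comp f val) val_enum_ord -map_take take_iota.
by rewrite (minn_idPl i_le).
Qed.

(** * Instances laid out on a grid of slots *)

(* Distinct slots start at least [2 m] apart, hence hold disjoint sub-intervals. *)
Definition placed {R : realType} (m : R) (len : nat -> R) (slot : nat -> nat)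
    (i : nat) : subinterval R :=
  (2 * m * (slot i)%:R, 2 * m * (slot i)%:R + len i).

Definition placed_instance {R : realType} (m : R) (n : nat) (len : nat -> R)
    (slot : nat -> nat) : n.-tuple (subinterval R) :=
  [tuple placed m len slot i | i < n].

Lemma placed_instanceP {R : realType} {m : R} {n : nat} {len : nat -> R}
    {slot : nat -> nat} :
  (forall i, 1 <= len i <= m) -> (forall i, (i < n)%N -> (slot i < n)%N) ->
  FL_UN_instance m (2 * m * n%:R) (placed_instance m n len slot).
Proof.
move=> len_bd slot_lt i; rewrite tnth_mktuple /placed.
have /andP[len_ge1 len_lem] := len_bd i.
have := slot_lt i (ltn_ord i); rewrite -(ler_nat R) -natr1 => slot_le.
have slot_ge0 : 0 <= (slot i)%:R :> R by [].
by split; nra.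
Qed.

Lemma placed_instance_le {R : realType} {m : R} {n : nat} {len : nat -> R}
    {slot : nat -> nat} :
  (forall i, 1 <= len i <= m) -> forall i,
  (tnth (placed_instance m n len slot) i).1 <=
  (tnth (placed_instance m n len slot) i).2.
Proof.
move=> len_bd i; rewrite tnth_mktuple /=.
by have /andP[len_ge1 len_lem] := len_bd i; lra.
Qed.

Lemma placed_length {R : realType} {m : R} {n : nat} {len : nat -> R}
    {slot : nat -> nat} (i : 'I_n) :
  (tnth (placed_instance m n len slot) i).2 -
  (tnth (placed_instance m n len slot) i).1 = len i.
Proof. by rewrite tnth_mktuple /=; lra. Qed.

Lemma Len_placed_le {R : realType} {m : R} {n : nat} {len : nat -> R}
    {slot : nat -> nat} (U : {set 'I_n}) : (forall i, 1 <= len i <= m) ->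
  (Len (placed_instance m n len slot) U <= (\sum_(i in U) len i)%:E)%E.
Proof.
move=> len_bd; apply: le_trans (Len_le_sum _ _ (placed_instance_le len_bd)) _.
by under eq_bigr do rewrite placed_length.
Qed.

Lemma Len_placed {R : realType} {m : R} {n : nat} {len : nat -> R}
    {slot : nat -> nat} (U : {set 'I_n}) : (forall i, 1 <= len i <= m) ->
  {in U &, forall i j : 'I_n, (i < j)%N -> (slot i < slot j)%N} ->
  Len (placed_instance m n len slot) U = (\sum_(i in U) len i)%:E.
Proof.
move=> len_bd slot_lt.
rewrite Len_disjoint; first by under eq_bigr do rewrite placed_length.
  exact: placed_instance_le.
move=> i j Ui Uj ij; rewrite !tnth_mktuple /=.
have := slot_lt i j Ui Uj ij; rewrite -(ler_nat R) -natr1 => slot_le.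
have /andP[len_ge1 len_lem] := len_bd i.
by nra.
Qed.

(** * The two continuations of the adversary *)

(** The algorithm is simulated on unit intervals alone, so the adversary knows this set before
    choosing a continuation. Both continuations use the same target, of right end [2 * m * n]. *)
Definition accepted_units {R : realType} (k : nat) (m : R) (n : nat)
    (A : decision_rule R) : {set 'I_n} :=
  let unit_ := placed m (fun=> 1) id in
  [set i : 'I_n |
    (i < k)%N && A (2 * m * n%:R) [seq unit_ j | j <- iota 0 i] (unit_ i)].

(** A decision reads only earlier releases, so any continuation of the [k] units leaves the first
    [k] decisions unchanged. *)
Lemma accepted_units_prefix {R : realType} {k n : nat} {m : R}
    {A : decision_rule R} {len : nat -> R} {slot : nat -> nat} :
  (forall i, (i < k)%N -> len i = 1) -> (forall i, (i < k)%N -> slot i = i) ->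
  accepted A (2 * m * n%:R) (placed_instance m n len slot) :&:
    [set i : 'I_n | (i < k)%N] = accepted_units k m n A.
Proof.
move=> len1 slotid; apply/setP => i; rewrite !inE andbC.
have unitE j : (j < k)%N -> placed m len slot j = placed m (fun=> 1) id j.
  by move=> jk; rewrite /placed len1 // slotid.
case: ltnP => //= ik; rewrite tnth_mktuple take_mktuple ?(ltnW (ltn_ord i)) //.
rewrite unitE //; congr (A _ _ _); apply/eq_in_map => j.
by rewrite mem_iota add0n => /= ji; apply/unitE/(ltn_trans ji).
Qed.

Lemma repeat_lower_bound {R : realType} {k n : nat} {m rho N D : R}
    {A : decision_rule R} : (0 < k)%N -> (k <= n)%N -> 1 < m ->
  competitive k m n A rho -> 0 < D -> 0 <= N ->
  N * (maxn #|accepted_units k m n A| 1)%:R <= D * k%:R -> N / D <= rho.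
Proof.
move=> k_gt0 kn hm comp D_gt0 N_ge0 ND.
set S := accepted_units k m n A in ND.
(* The interval to repeat: an accepted one if there is any, otherwise the first, which may then add
   one unit to the algorithm's cover; hence the maximum with 1. *)
have [j jk jS] : exists2 j : 'I_n, (j < k)%N & (#|j |: S| <= maxn #|S| 1)%N.
  case: (set_0Vmem S) => [S0|[j Sj]].
    exists (Ordinal (leq_trans k_gt0 kn)) => //.
    by rewrite S0 finset.setU0 cards1 leq_maxr.
  exists j; first by move: Sj; rewrite inE => /andP[].
  by rewrite (finset.setUidPr _) ?leq_maxl // finset.sub1set.
pose slot i := if (i < k)%N then i else nat_of_ord j.
have len_bd (i : nat) : 1 <= (1 : R) <= m by rewrite lexx ltW.
pose V := placed_instance m n (fun=> 1) slot.
have prefix : accepted A (2 * m * n%:R) V :&: [set i : 'I_n | (i < k)%N] = S.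
  by apply: accepted_units_prefix => // i ik; rewrite /slot ik.
apply: (@competitive_lower_bound R k n m A rho (2 * m * n%:R) V k%:R
          (maxn #|S| 1)%:R N D) => //.
- apply: placed_instanceP => // i i_lt; rewrite /slot; case: ifP => // _.
- have cardE : #|[set i : 'I_n | (0 <= i < k)%N]| = k.
    by rewrite card_ord_range ?subn0 //= kn.
  have := @le_OPT R k n V [set i : 'I_n | (0 <= i < k)%N].
  rewrite cardE leqnn => /(_ isT); rewrite Len_placed //.
    by rewrite sumr_const cardE.
  by move=> i i'; rewrite !inE /slot => /= -> ->.
- apply: le_trans (Len_subset V _ (j |: S) _) _.
    move=> i Ui; case: (ltnP i k) => ik.
      exists i => //; rewrite finset.in_setU -prefix.
      by rewrite finset.in_setI Ui finset.in_set ik orbT.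
    exists j; first by rewrite setU11.
    by rewrite !tnth_mktuple /placed /slot jk ltnNge ik.
  apply: le_trans (Len_placed_le _ len_bd) _.
  by rewrite sumr_const lee_fin ler_nat.
- by rewrite ltr0n.
Qed.

(** All later releases are long and new. At most [k] acceptances, of which [accepted_units] are
    short, bound the algorithm, while offline [p] units can be exchanged for long intervals. *)
Lemma upgrade_lower_bound {R : realType} {k n p : nat} {m rho N D : R}
    {A : decision_rule R} : (0 < k)%N -> (p <= k)%N -> (k + p <= n)%N -> 1 < m ->
  online_algorithm k m n A -> competitive k m n A rho -> 0 < D -> 0 <= N ->
  N * (m * k%:R - (m - 1) * #|accepted_units k m n A|%:R) <=
    D * (m * k%:R - (m - 1) * (k - p)%:R) -> N / D <= rho.
Proof.
move=> k_gt0 pk kpn hm alg comp D_gt0 N_ge0 ND.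
set S := accepted_units k m n A in ND.
pose len i : R := if (i < k)%N then 1 else m.
have len_bd i : 1 <= len i <= m.
  by rewrite /len; case: ifP => _; rewrite lexx ltW.
pose V := placed_instance m n len id.
have prefix : accepted A (2 * m * n%:R) V :&: [set i : 'I_n | (i < k)%N] = S.
  by apply: accepted_units_prefix => // i ik; rewrite /len ik.
have inst : FL_UN_instance m (2 * m * n%:R) V by apply: placed_instanceP.
apply: (@competitive_lower_bound R k n m A rho (2 * m * n%:R) V
          (m * k%:R - (m - 1) * (k - p)%:R)
          (m * k%:R - (m - 1) * #|S|%:R) N D) => //.
(* A window of [k] consecutive releases: the last [k - p] units and the first [p] long intervals. *)
- pose U := [set i : 'I_n | (p <= i < k + p)%N].
  have cardU : #|U| = k by rewrite card_ord_range ?addnK // leq_addl.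
  have := @le_OPT R k n V U; rewrite cardU leqnn => /(_ isT).
  rewrite Len_placed // sum_short_long cardU.
  suff -> : U :&: [set i : 'I_n | (i < k)%N] = [set i : 'I_n | (p <= i < k)%N].
    by rewrite card_ord_range // pk; lia.
  by apply/setP => i; rewrite !inE; lia.
- apply: le_trans (Len_placed_le _ len_bd) _.
  rewrite sum_short_long prefix lee_fin.
  have := alg _ _ inst; rewrite -(ler_nat R) => card_le.
  by nra.
- have : (k - p)%:R <= k%:R :> R by rewrite ler_nat leq_subr.
  have : 0 < k%:R :> R by rewrite ltr0n.
  by nra.
Qed.

(** * Balancing the two continuations *)

Theorem theorem3 (R : realType) (k n : nat) (m : R)
    (hk : (2 <= k)%N) (hm : 1 < m) (hn : (k + 1 <= n)%N) :
  (forall A : decision_rule R, online_algorithm k m n A ->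
     forall rho : R, competitive k m n A rho ->
       2 * k%:R * m / (2 * k%:R * m + (1 - m) * (minn k (n - k))%:R) <= rho)
  /\ 2 * k%:R * m / (2 * k%:R * m + (1 - m) * (minn k (n - k))%:R) < 2 :> R.
Proof.
set p := minn k (n - k).
have pk : (p <= k)%N by apply: geq_minl.
have kpn : (k + p <= n)%N by rewrite /p; lia.
have k_gt0 : (0 < k)%N by lia.
have kR : 2 <= k%:R :> R by rewrite (ler_nat R 2).
have pR : p%:R <= k%:R :> R by rewrite ler_nat.
have pR0 : 0 <= p%:R :> R by [].
have D_gt0 : 0 < 2 * k%:R * m + (1 - m) * p%:R by nra.
have N_ge0 : 0 <= 2 * k%:R * m by nra.
(* Being below 2 amounts to [(m - 1) * p < k * m], which follows from [p <= k]. *)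
split; last by rewrite ltr_pdivrMr //; nra.
move=> A alg rho comp.
set x := #|accepted_units k m n A|.
have [few|many] := leqP (2 * maxn x 1 + p) (2 * k).
  apply: (repeat_lower_bound k_gt0 _ hm comp) => //; first by lia.
  rewrite -/x; move: few; rewrite -(ler_nat R) natrD !natrM => few.
  set X := (maxn x 1)%:R in few *.
  (* After division by [k] the goal is [2 * m * X <= 2 * k * m - m * p + p]; this bound gives it
     with [p] to spare. *)
  have : m * (2 * X + p%:R) <= m * (2 * k%:R) by rewrite ler_pM2l // (lt_trans _ hm).
  by nra.
apply: (upgrade_lower_bound k_gt0 pk kpn hm alg comp) => //.
have {}many : (2 * k <= 2 * x + p)%N by lia.
rewrite -/x natrB //; move: many; rewrite -(ler_nat R) natrD !natrM => many.
set opt := m * k%:R - (m - 1) * (k%:R - p%:R).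
(* The algorithm gets at most [opt - c], and the denominator is [2 * k * m - 2 * c]. The goal thus
   reduces to [2 * c * opt <= 2 * k * m * c], which is [opt_le] times [c]. *)
pose c := (m - 1) * p%:R / 2.
have c_ge0 : 0 <= c by rewrite /c; nra.
have opt_le : 2 * opt <= 2 * k%:R * m by rewrite /opt; nra.
apply: (@le_trans _ _ (2 * k%:R * m * (opt - c))).
  have : (m - 1) * (2 * k%:R) <= (m - 1) * (2 * x%:R + p%:R).
    by rewrite ler_pM2l // subr_gt0.
  by move=> ?; apply: ler_wpM2l => //; rewrite /opt /c; lra.
have -> : 2 * k%:R * m + (1 - m) * p%:R = 2 * k%:R * m - 2 * c.
  by rewrite /c; lra.
by nra.
Qed.
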